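(* Let $g\ge 1$ be an integer. Every $g$-Golomb ruler $\mathcal{A}$ satisfies $$\limsup_{n\to\infty} \frac{|\mathcal{A}\cap[0,n)|}{\sqrt{n}} \le \sqrt{g}.$$ Moreover, there is a $g$-Golomb ruler $\mathcal{G}$ with $$\limsup_{n\to\infty} \frac{|\mathcal{G}\cap[0,n)|}{\sqrt{n}} \ge \frac{1}{\sqrt{2}}\,\sqrt{g}.$$
   Context: For a positive integer $g$, a set $\mathcal{A}$ of nonnegative integers (finite or infinite) is a $g$-Golomb ruler if for each integer $d>0$ there are at most $g$ pairs $(a,b)\in\mathcal{A}\times\mathcal{A}$ with $d=a-b$. Here $n$ runs through positive integers. *)

(* Defs.v *)
From HB Require Import structures.
From mathcomp Require Import all_boot all_order all_algebra finmap.
From mathcomp Require Import all_classical all_reals all_analysis.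
Import Order.TTheory GRing.Theory Num.Theory.
Import numFieldNormedType.Exports.

Set Implicit Arguments.
Unset Strict Implicit.
Unset Printing Implicit Defensive.

Local Open Scope classical_set_scope.
Local Open Scope card_scope.
Local Open Scope ring_scope.

(* The difference is taken in int: subtraction on nat is truncated.  The set of
   pairs may a priori be infinite, so "at most g pairs" is stated by [card_le]. *)
Definition golomb_ruler (g : nat) (A : set nat) : Prop :=
  forall d : int, 0 < d ->
    [set p : nat * nat | [/\ A p.1, A p.2 & d = p.1%:Z - p.2%:Z]] #<= `I_g.

(* |A ∩ [0, n)|; [fset_set] is faithful here because the set is finite. *)
Definition count_below (A : set nat) (n : nat) : nat :=
  #|` fset_set (A `&` `I_n)|.

(* The term of index 0 is 0 and does not affect the limit superior, which is
   taken in \bar R so that it exists without any boundedness assumption. *)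
Definition ruler_limsup (R : realType) (A : set nat) : \bar R :=
  limn_esup (fun n : nat => ((count_below A n)%:R / Num.sqrt (n%:R : R))%:E).

(* Main.v *)
Require Import Defs.
From HB Require Import structures.
From mathcomp Require Import all_boot all_order all_algebra finmap.
From mathcomp Require Import all_solvable all_field.
From mathcomp Require Import zify ring.
From mathcomp Require Import all_classical all_reals all_analysis.
Import Order.TTheory GRing.Theory Num.Theory.
Import numFieldNormedType.Exports.

Set Implicit Arguments.
Unset Strict Implicit.
Unset Printing Implicit Defensive.

(** Upper bound.  Let [N] be the number of elements of the ruler below [n].
    Slide a window of length [w] over [0, n + w) and let [c u] be the number of
    elements it contains in position [u].  The [c u] sum to [w * N], and in the
    sum of their squares every pair of offsets [i <> j] in the window
    contributes at most [g], because the ruler has at most [g] pairs at distance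
    [`|i - j|].  The Cauchy-Schwarz inequality then gives
    [w * N ^ 2 <= (n + w) * (N + w * g)] ([window_bound]).  With [w] about
    [n / k], this is [N <= sqrt (g n) (1 + 1 / k) + k + 1] ([golomb_count_le]),
    and [k] is arbitrary.

    Lower bound.  Let [q = p ^ totient g] for a large prime [p], so that [g]
    divides [q - 1], and let [z] generate the multiplicative group of the field
    with [q ^ 2] elements.  The discrete logarithms of the [z + a], for [a] in
    the subfield [K] of order [q], form a Sidon set modulo [q ^ 2 - 1] (Bose).
    Reduced modulo [m = (q ^ 2 - 1) / g] they stay distinct, and every nonzero
    difference modulo [m] lifts to [g] differences modulo [q ^ 2 - 1], so they
    form a [g]-Golomb ruler in [0, m) with [q > sqrt (g m)] elements
    ([dense_finite_ruler]).

    To get an infinite ruler, start from a finite ruler [A] in [0, n), take such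
    a dense ruler [B] in [0, m) with [m] huge compared to [n], discard from [B]
    at most [n * g] elements so that no difference in [1, n] remains, and add
    the rest, translated by [m + n], to [A] ([glue]).  A difference between the
    two parts is larger than every difference inside one part, and it occurs
    only once, so the union is still [g]-Golomb; it has about [sqrt (g m)] elements
    in an interval of length about [2 m], whence the constant [sqrt (g / 2)].
    The union of the successive extensions ([exists_dense_ruler]) is the desired
    ruler. *)

(** * Golomb rulers through lists of repetitions *)

(** A positive difference [d] occurs at most [g] times in [P]; an occurrence
    [(b + d, b)] is represented by its smaller element [b]. *)
Definition repeats_le (g : nat) (P : pred nat) : Prop :=
  forall (d : nat) (s : seq nat), 0 < d -> uniq s ->
    all (fun b => P b && P (b + d)) s -> size s <= g.

(** The number of elements of [P] below [n]. *)
Definition count_lt (P : pred nat) (n : nat) : nat := count P (iota 0 n).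

Lemma count_lt_sum (P : pred nat) n : count_lt P n = \sum_(0 <= x < n) P x.
Proof. by rewrite /count_lt -sum1_count big_mkcond /index_iota subn0. Qed.

Section Bridge.
Local Open Scope classical_set_scope.
Local Open Scope card_scope.

Lemma card_le_II_sub (T : choiceType) (D : set T) g :
  D #<= `I_g <-> forall s : seq T, uniq s -> [set` s] `<=` D -> size s <= g.
Proof.
split=> [D_g s s_uniq sD|D_s].
  rewrite -(undup_id s_uniq) -card_fseq -card_le_II.
  have /card_eq_fsetP/card_le_eql <- := erefl #|` [fset x in s]%fset|.
  apply: card_le_trans (subset_card_le _) D_g => x /=; rewrite inE => xs.
  exact: sD.
have fset_le (X : {fset T}) : [set` X] `<=` D -> #|` X| <= g.
  by move=> XD; apply: D_s => //; apply: fset_uniq.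
have [D_fin|/infinite_set_fset-/(_ g.+1)[X /fset_le]] :=
  pselect (finite_set D); last by lia.
have [X DX] : exists X : {fset T}, D = [set` X] by apply/finite_fsetP.
rewrite DX; have /card_eq_fsetP/card_le_eql -> := erefl #|` X|.
by rewrite card_le_II; apply: fset_le; rewrite DX.
Qed.

Lemma golombP g (A : set nat) :
  golomb_ruler g A <-> repeats_le g (fun x => x \in A).
Proof.
split=> [A_g d s d_gt0 s_uniq /allP sA|A_rep d d_gt0].
  have d_gt0' : (0 < d%:Z)%R by [].
  have /card_le_II_sub cD := A_g _ d_gt0'.
  rewrite -(size_map (fun b => (b + d, b))); apply: cD.
    by rewrite map_inj_uniq // => x y [].
  move=> _ /mapP[b /sA/andP[Ab Abd] ->] /=.
  by split; [exact: set_mem | exact: set_mem | lia].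
apply/card_le_II_sub => s s_uniq sD; have d_gt0' : 0 < `|d|%N by lia.
rewrite -(size_map snd); apply: (A_rep _ _ d_gt0').
  rewrite map_inj_in_uniq // => -[a b] [a' b']
    /sD[_ _ /= e1] /sD[_ _ /= e2] /= e.
  by congr pair; lia.
apply/allP => _ /mapP[[a b] /sD[/= Aa Ab e] ->] /=.
by rewrite (_ : b + `|d|%N = a) ?mem_set //; lia.
Qed.

Lemma count_belowE (A : set nat) n :
  count_below A n = count_lt (fun x => x \in A) n.
Proof.
rewrite /count_below /count_lt -size_filter.
rewrite (_ : A `&` `I_n = [set` [fset x in [seq x <- iota 0 n | x \in A]]%fset]).
  by rewrite set_fsetK card_fseq undup_id // filter_uniq ?iota_uniq.
apply/seteqP; split=> x /=; rewrite inE mem_filter mem_iota /=.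
  by case=> Ax ->; rewrite mem_set.
by move=> /andP[/set_mem Ax lt]; split.
Qed.
End Bridge.

(** * Extending a finite ruler *)

Section Step.
Variables (g n m : nat) (A B : pred nat).

(** The elements of [B] that are not followed by another element of [B] at
    distance at most [n]. *)
Definition thin : pred nat :=
  fun b => B b && ~~ has (fun d => B (b + d)) (iota 1 n).

Lemma thin_gap b d : 0 < d -> thin b -> thin (b + d) -> n < d.
Proof.
move=> d_gt0 /andP[_ /hasPn noB] /andP[Bbd _].
by rewrite ltnNge; apply: contraL Bbd => le_dn; apply: noB;
   rewrite mem_iota; lia.
Qed.

Hypothesis B_rep : repeats_le g B.

(** Each distance [1 <= d <= n] causes the loss of at most [g] elements. *)
Lemma count_thin : count_lt B m <= count_lt thin m + n * g.
Proof.
have -> : count_lt B m = count_lt thin m +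
    count (fun b => B b && has (fun d => B (b + d)) (iota 1 n)) (iota 0 m).
  rewrite /count_lt -count_predUI [X in _ + X](_ : _ = 0) ?addn0.
    by apply: eq_count => b /=; rewrite /thin; case: (B b); case: (has _ _).
  by apply/eqP; rewrite -leqn0 leqNgt -has_count; apply/hasPn => b _ /=;
     rewrite /thin; case: (B b); case: (has _ _).
rewrite leq_add2l.
apply: (@leq_trans (\sum_(d <- iota 1 n)
          count (fun b => B b && B (b + d)) (iota 0 m))); last first.
  apply: (@leq_trans (\sum_(d <- iota 1 n) g)); last first.
    by rewrite big_const_seq count_predT size_iota iter_addn_0 mulnC.
  rewrite big_seq [X in _ <= X]big_seq; apply: leq_sum => d.
  rewrite mem_iota => /andP[d_gt0 _]; rewrite -size_filter.
  apply: (B_rep d_gt0).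
    by rewrite filter_uniq ?iota_uniq.
  exact: filter_all.
elim: (iota 1 n) => [|d ds IH] /=.
  by rewrite big_nil leqNgt -has_count; apply/hasPn => b _ /=;
     rewrite andbF.
rewrite big_cons; apply: leq_trans (leq_add (leqnn _) IH).
rewrite -count_predUI; apply: leq_trans (leq_addr _ _).
by apply: sub_count => b /=;
   case: (B b); case: (B (b + d)).
Qed.

(** The part of [A] below [n], followed by [thin] translated by [m + n]. *)
Definition glue : pred nat :=
  fun x => if x < n then A x else (m + n <= x) && thin (x - (m + n)).

Hypothesis B_lt : forall x, B x -> x < m.

Lemma glue_lt x : glue x -> x < 2 * m + n.
Proof.
rewrite /glue; case: ltnP => [|_ /andP[h /andP[/B_lt h' _]]]; lia.
Qed.

Lemma count_glue : count_lt B m <= count_lt glue (2 * m + n) + n * g.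
Proof.
apply: leq_trans count_thin _; rewrite leq_add2r /count_lt.
rewrite (_ : 2 * m + n = (m + n) + m); last by lia.
rewrite iotaD count_cat; apply: leq_trans (leq_addl _ _).
have -> : iota (0 + (m + n)) m = map (addn (m + n)) (iota 0 m).
  by rewrite -iotaDl addn0.
rewrite count_map; apply: sub_count => x /= tx.
rewrite /glue (_ : m + n + x < n = false); last by lia.
by rewrite leq_addr /= (_ : m + n + x - (m + n) = x) //; lia.
Qed.

Hypothesis g_gt0 : 0 < g.
Hypothesis le_nm : n <= m.
Hypothesis A_rep : repeats_le g A.

Lemma glue_rep : repeats_le g glue.
Proof.
move=> d s d_gt0 s_uniq /allP s_glue.
have A_or b : b \in s -> (if b < n then
   if b + d < n then A b && A (b + d) else
     (m + n <= b + d) && thin (b + d - (m + n))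
   else [&& m + n <= b, thin (b - (m + n)) & thin (b - (m + n) + d)]).
  move/s_glue/andP; rewrite /glue => -[].
  case: (ltnP b n) => [_|le_nb].
    by case: ltnP => // _ -> ->.
  have -> : b + d < n = false by lia.
  move=> /andP[le_mb ->] /andP[_]; rewrite le_mb /=.
  by have -> : b + d - (m + n) = b - (m + n) + d by lia.
have [le_dn|lt_nd] := leqP d n.
  (* small differences occur inside A only *)
  apply: (A_rep d_gt0 s_uniq); apply/allP => b /A_or.
  case: ltnP => [lt_bn|le_nb]; last first.
    by case/and3P=> _ t1 t2; have := thin_gap d_gt0 t1 t2; lia.
  by case: ltnP => // _ /andP[]; lia.
have [lt_dm|le_md] := ltnP d m.
  (* differences in (n, m) occur inside the translate of thin only *)
  have s_ge b : b \in s -> [&& m + n <= b, B (b - (m + n)) & B (b - (m + n) + d)].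
    move/A_or; case: ltnP => [lt_bn|le_nb].
      by rewrite (_ : b + d < n = false); [move=> /andP[]; lia | lia].
    by case/and3P=> -> /andP[-> _] /andP[-> _].
  rewrite -(size_map (fun b => b - (m + n))).
  apply: (B_rep d_gt0).
    rewrite map_inj_in_uniq // => x y /s_ge/andP[hx _] /s_ge/andP[hy _]; lia.
  by apply/allP => _ /mapP[b /s_ge/and3P[_ h1 h2] ->]; rewrite h1.
(* differences at least m occur between A and the translate of thin only *)
have s_cross b : b \in s -> [&& b < n, m + n <= b + d & thin (b + d - (m + n))].
  move/A_or; case: ltnP => [lt_bn|le_nb].
    rewrite (_ : b + d < n = false); last by lia.
    by case/andP=> -> ->.
  by case/and3P=> _ _ /andP[/B_lt]; lia.
(* two occurrences of the same cross difference would yield a difference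
   smaller than n in thin, so there is at most one occurrence *)
apply: leq_trans g_gt0; case: s s_uniq s_cross {s_glue A_or} => [|x [|y s]] //=.
rewrite inE negb_or => /andP[/andP[/eqP neq_xy _] _] cross.
have /and3P[x1 x2 x3] := cross x (mem_head _ _).
have /and3P[y1 y2 y3] : [&& y < n, m + n <= y + d & thin (y + d - (m + n))].
  by apply: cross; rewrite !inE eqxx orbT.
have [lt_xy|lt_yx|//] := ltngtP x y.
  have := @thin_gap (x + d - (m + n)) (y - x).
  rewrite x3 (_ : _ + (y - x) = y + d - (m + n)) ?y3; last by lia.
  by move=> /(_ _ isT isT); lia.
have := @thin_gap (y + d - (m + n)) (x - y).
rewrite y3 (_ : _ + (x - y) = x + d - (m + n)) ?x3; last by lia.
by move=> /(_ _ isT isT); lia.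
Qed.

End Step.

(** * Bose rulers in finite fields *)

Section Bose.
Local Open Scope ring_scope.

Lemma finField_prim_root (F : finFieldType) :
  exists z : F, (#|F|.-1).-primitive_root%R z.
Proof.
have cF : (1 < #|F|)%N := finNzRing_gt1 F.
have : has #|F|.-1.-primitive_root [seq x <- enum F | x != 0].
  apply: has_prim_root; first by lia.
  - apply/allP => x; rewrite mem_filter => /andP[x_neq0 _]; rewrite unity_rootE.
    apply/eqP/(mulfI x_neq0); rewrite -exprS prednK ?expf_card ?mulr1 //; lia.
  - by rewrite filter_uniq ?enum_uniq.
  - rewrite size_filter -(leq_add2l (count (pred1 (0 : F)) (enum F))).
    rewrite (count_predC (pred1 (0 : F))) -cardE count_uniq_mem ?enum_uniq //.
    by apply: leq_trans (leq_add (leq_b1 _) (leqnn _)) _;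
       rewrite add1n prednK // ltnW.
by case/hasP => z _ hz; exists z.
Qed.

Variables (F : finFieldType) (q g m : nat).
Hypothesis F_card : #|F| = (q * q)%N.
Hypothesis q_gt1 : (1 < q)%N.
Hypothesis q_char : [pchar F].-nat q.
Hypothesis g_gt0 : (0 < g)%N.
Hypothesis g_dvd : (g %| q.-1)%N.
Hypothesis gm_eq : (g * m = (q * q).-1)%N.

Variable z : F.
Hypothesis z_prim : (q * q).-1.-primitive_root z.

(** The subfield of order [q] of [F], that is, the fixed points of the
    [q]-power Frobenius map. *)
Definition baseF : pred F := fun x => x ^+ q == x.

Lemma baseFB x y : baseF x -> baseF y -> baseF (x - y).
Proof.
by move=> /eqP hx /eqP hy; rewrite /baseF exprDn_pchar // exprNn_pchar // hx hy.
Qed.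

Lemma baseFM x y : baseF x -> baseF y -> baseF (x * y).
Proof. by move=> /eqP hx /eqP hy; rewrite /baseF exprMn hx hy. Qed.

Lemma baseFV x : baseF x -> baseF x^-1.
Proof. by move=> /eqP hx; rewrite /baseF exprVn hx. Qed.

Lemma baseFN x : baseF x -> baseF (- x).
Proof. by move=> /eqP hx; rewrite /baseF exprNn_pchar // hx. Qed.

(** The [g]-th roots of unity lie in the subfield because [g] divides
    [q - 1]. *)
Lemma baseF_unity x : x ^+ g = 1 -> baseF x.
Proof.
move=> xg; have /dvdnP[k qk] := g_dvd.
by rewrite /baseF -(prednK (ltnW q_gt1)) exprS qk mulnC exprM xg expr1n mulr1.
Qed.

Lemma z_neq0 : z != 0.
Proof.
apply/eqP => z0; have := prim_expr_order z_prim; rewrite z0 expr0n.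
rewrite (_ : (_ == 0)%N = false); last by nia.
by move/eqP; rewrite eq_sym oner_eq0.
Qed.

Lemma z_notin_baseF : ~~ baseF z.
Proof.
apply/eqP => zq.
have : z ^+ q.-1 == 1.
  apply/eqP/(mulfI z_neq0); rewrite -exprS prednK ?zq ?mulr1 //; lia.
rewrite -(prim_order_dvd z_prim) => /dvdn_leq; nia.
Qed.

(** As [z] is outside the subfield, [1] and [z] are linearly independent over
    it. *)
Lemma baseF_free u v : baseF u -> baseF v -> u * z = v -> u = 0 /\ v = 0.
Proof.
move=> hu hv e; have [u0|un0] := eqVneq u 0.
  by split=> //; rewrite -e u0 mul0r.
case/negP: z_notin_baseF.
by rewrite (_ : z = v * u^-1); [apply/baseFM/baseFV | rewrite -e mulrC mulKf].
Qed.

Lemma zD_neq0 a : baseF a -> z + a != 0.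
Proof.
move=> ha; apply/eqP => /eqP; rewrite addr_eq0 => /eqP e.
by case/negP: z_notin_baseF; rewrite e baseFN.
Qed.

(** The Sidon property: a quotient [(z + a) / (z + b)] other than [1]
    determines [a] and [b].  Both products are monic polynomials in [z] of
    degree 2, so linear independence identifies their other coefficients. *)
Lemma zD_quot a a' b b' : baseF a -> baseF a' -> baseF b -> baseF b' ->
  (z + a) * (z + b') = (z + a') * (z + b) -> a = b \/ (a = a' /\ b = b').
Proof.
move=> ha ha' hb hb' e.
have [|||e1 e2] := @baseF_free (a + b' - (a' + b)) (a' * b - a * b').
- rewrite (_ : _ - _ = (a - a') - (b - b')); last by ring.
  by do !apply: baseFB.
- by apply: baseFB; apply: baseFM.
- by apply/eqP; rewrite -subr_eq0; move/eqP: e; rewrite -subr_eq0 => /eqP e;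
     apply/eqP; rewrite -[RHS]e; ring.
have : (a - b) * (a - a') == 0.
  apply/eqP; transitivity (a * (a + b' - (a' + b)) + (a' * b - a * b')).
    by ring.
  by rewrite e1 e2 mulr0 addr0.
rewrite mulf_eq0 !subr_eq0 => /orP[/eqP->|/eqP eaa]; [by left | right; split=> //].
by apply/eqP; rewrite eq_sym -subr_eq0 -e1 eaa; apply/eqP; ring.
Qed.

(** The elements [z + a] stay distinct modulo the [g]-th roots of unity. *)
Lemma zD_pow_inj a b : baseF a -> baseF b ->
  (z + a) ^+ g = (z + b) ^+ g -> a = b.
Proof.
move=> ha hb e; pose c := (z + a) / (z + b).
have hc : baseF c.
  by apply: baseF_unity; rewrite expr_div_n e divff // expf_neq0 // zD_neq0.
have ec : z + a = c * (z + b) by rewrite /c mulfVK // zD_neq0.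
have [|||e1 e2] := @baseF_free (1 - c) (c * b - a).
- by apply: baseFB => //; rewrite /baseF expr1n.
- by apply: baseFB => //; apply: baseFM.
- apply/eqP; rewrite -subr_eq0; apply/eqP.
  by transitivity (z + a - c * (z + b)); [ring | rewrite -ec subrr].
by move/eqP: e1 e2; rewrite subr_eq0 => /eqP <- /eqP; rewrite mul1r subr_eq0 => /eqP.
Qed.

(** The residues [x] modulo [m] of the discrete logarithms to base [z] of the
    [z + a], for [a] in the subfield.  Since the order of [z] is [g * m],
    congruence modulo [m] of the logarithms is equality of the [g]-th powers. *)
Definition bose : pred nat := fun x =>
  (x < m)%N && [exists a : F, baseF a && ((z ^+ x) ^+ g == (z + a) ^+ g)].

(** An element [a] of the subfield witnessing that [x] is in [bose]; the value
    is [0] for [x] outside [bose]. *)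
Definition bose_root (x : nat) : F :=
  odflt 0 [pick a | baseF a && ((z ^+ x) ^+ g == (z + a) ^+ g)].

Lemma bose_rootP x : bose x ->
  baseF (bose_root x) /\ (z ^+ x) ^+ g = (z + bose_root x) ^+ g.
Proof.
case/andP=> _ /existsP[a ha]; rewrite /bose_root.
by case: pickP => [b /andP[hb /eqP]//|/(_ a)]; rewrite ha.
Qed.

Lemma m_gt0 : (0 < m)%N. Proof. nia. Qed.

Lemma pow_zg x y : (z ^+ x) ^+ g = (z ^+ y) ^+ g -> x = y %[mod m].
Proof.
rewrite -!exprM => /eqP; rewrite (eq_prim_root_expr z_prim) -gm_eq mulnC (mulnC y).
by rewrite -!muln_modr eqn_pmul2l // => /eqP.
Qed.

Lemma bose_rep : repeats_le g bose.
Proof.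
move=> d s d_gt0 s_uniq /allP s_bose.
(* w sends an occurrence of d to a g-th root of unity, injectively *)
pose w b := (z + bose_root (b + d)) / ((z + bose_root b) * z ^+ d).
rewrite -(size_map w); apply: max_unity_roots => //.
  apply/allP => _ /mapP[b /s_bose/andP[/bose_rootP[h1 e1] /bose_rootP[h2 e2]] ->].
  rewrite /w unity_rootE expr_div_n exprMn -e1 -e2 -exprMn -exprD divff //.
  by rewrite !expf_neq0 ?z_neq0.
rewrite map_inj_in_uniq // => b b' /s_bose/andP[Bb Bbd] /s_bose/andP[Bb' Bbd'].
have [h1 e1] := bose_rootP Bb; have [h2 e2] := bose_rootP Bbd.
have [h1' e1'] := bose_rootP Bb'; have [h2' e2'] := bose_rootP Bbd'.
have lt_m x : bose x -> (x < m)%N by case/andP.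
have zd0 : z ^+ d != 0 by rewrite expf_neq0 ?z_neq0.
rewrite /w => /eqP; rewrite eqr_div ?mulf_neq0 ?zD_neq0 // !mulrA.
move=> /eqP/(mulIf zd0) e.
have [eab|[_ ebb]] := zD_quot h2 h2' h1 h1' e.
  (* equal roots at b and b + d would make d a multiple of m *)
  have := lt_m _ Bbd; have := lt_m _ Bb.
  have /pow_zg : (z ^+ (b + d)) ^+ g = (z ^+ b) ^+ g by rewrite e1 e2 eab.
  by move=> + h h'; rewrite !modn_small // ; lia.
have /pow_zg : (z ^+ b) ^+ g = (z ^+ b') ^+ g by rewrite e1 e1' ebb.
by rewrite !modn_small // lt_m.
Qed.

Lemma card_baseF : exists2 s : seq F, uniq s & (size s = q) /\ all baseF s.
Proof.
(* besides 0, the powers of z ^+ q.+1, which has order q.-1 *)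
exists (0 :: [seq z ^+ (q.+1 * i) | i <- iota 0 q.-1]).
  rewrite /= map_inj_in_uniq ?iota_uniq ?andbT.
    by apply/mapP => -[i _ /esym/eqP]; rewrite expf_eq0 (negbTE z_neq0) andbF.
  move=> i j; rewrite !mem_iota => hi hj /eqP.
  rewrite (eq_prim_root_expr z_prim) !modn_small; [|nia|nia].
  by rewrite eqn_pmul2l // => /eqP.
split; first by rewrite /= size_map size_iota prednK // ltnW.
apply/allP => x; rewrite inE => /orP[/eqP->|/mapP[i _ ->]].
  by rewrite /baseF expr0n (_ : (q == 0)%N = false) //; lia.
rewrite /baseF -exprM (eq_prim_root_expr z_prim).
rewrite (_ : (q.+1 * i * q = i * (q * q).-1 + q.+1 * i)%N); last by nia.
by rewrite modnMDl.
Qed.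

Lemma card_bose : (q <= count_lt bose m)%N.
Proof.
have [s s_uniq [<- /allP s_base]] := card_baseF.
pose P x a := (x < m)%N && ((z ^+ x) ^+ g == (z + a) ^+ g).
have ex a : a \in s -> exists x, P x a.
  move=> /s_base ha.
  have n0 := zD_neq0 ha.
  have [i e] : exists i, z + a = z ^+ i.
    have : (z + a) ^+ (q * q).-1 = 1.
      apply: (mulfI n0); rewrite -exprS prednK ?mulr1; last by nia.
      by rewrite -F_card expf_card.
    by move=> h; have [i ->] := prim_rootP z_prim h; exists i.
  exists (i %% m)%N; rewrite /P ltn_mod m_gt0 e -!exprM.
  rewrite (eq_prim_root_expr z_prim) -gm_eq mulnC (mulnC i) -!muln_modr.
  by rewrite modn_mod eqxx.
pose f a := if pselect (exists x, P x a) is left h then xchoose h else 0%N.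
have fP a : a \in s -> P (f a) a.
  by move=> /ex h; rewrite /f; case: pselect => // h'; exact: (xchooseP h').
rewrite -(size_map f) /count_lt -size_filter; apply: uniq_leq_size.
  rewrite map_inj_in_uniq // => a b ha hb e.
  have /andP[_ /eqP ea] := fP _ ha; have /andP[_ /eqP eb] := fP _ hb.
  by apply: zD_pow_inj; rewrite ?s_base // -ea -eb e.
move=> _ /mapP[a ha ->]; have /andP[lt_m ea] := fP _ ha.
rewrite mem_filter mem_iota /= lt_m andbT /bose lt_m.
by apply/existsP; exists a; rewrite s_base.
Qed.
End Bose.

(** Arbitrarily long [g]-Golomb rulers in [0, m) with more than [sqrt (g m)]
    elements. *)
Lemma dense_finite_ruler g N : 0 < g -> exists q m (B : pred nat),
  [/\ N < q, g * m = (q * q).-1, (forall x, B x -> x < m), repeats_le g B &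
      q <= count_lt B m].
Proof.
move=> g_gt0; have [p lt_p pr_p] := prime_above (maxn g N).
have [lt_gp lt_Np] : g < p /\ N < p by lia.
have cop : coprime p g by rewrite prime_coprime // gtnNdvd.
pose q := p ^ totient g.
have t_gt0 : 0 < totient g by rewrite totient_gt0.
have le_pq : p <= q by rewrite -{1}(expn1 p) leq_exp2l // prime_gt1.
have p_gt1 := prime_gt1 pr_p.
have g_dvd : g %| q.-1.
  rewrite -subn1 -eqn_mod_dvd; last by lia.
  by apply/eqP/Euler_exp_totient.
have /dvdnP[m gm] : g %| (q * q).-1.
  by rewrite (_ : _.-1 = q.-1 * q.+1); [exact: dvdn_mulr | nia].
have k_gt0 : 0 < totient g * 2 by lia.
have [F pcharF cardF] := PrimePowerField pr_p k_gt0.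
have F_card : #|F| = q * q by rewrite cardF expnM -mulnn.
have [z] := @finField_prim_root F.
rewrite F_card => z_prim.
have q_char : [pchar F]%R.-nat q.
  by rewrite (eq_pnat _ (pcharf_eq pcharF)) pnatX pnat_id.
have q_gt1 : 1 < q by lia.
have gm_eq : g * m = (q * q).-1 by rewrite mulnC.
exists q, m, (bose q g m z); split=> //.
- by lia.
- by move=> x /andP[].
- exact: (bose_rep F_card).
- exact: (card_bose F_card).
Qed.

(** * An infinite dense ruler *)

(** [S] is a [g]-Golomb ruler contained in [0, n). *)
Definition bounded_ruler (g n : nat) (S : pred nat) : Prop :=
  repeats_le g S /\ forall x, S x -> x < n.

Lemma extend_ruler g n (S : pred nat) k : 0 < g -> bounded_ruler g n S ->
  exists n' S', [/\ bounded_ruler g n' S', maxn n k < n',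
    (forall x, x < n -> S' x = S x) &
    g * n' * k ^ 2 <= 2 * (k.+1 * count_lt S' n') ^ 2].
Proof.
move=> g_gt0 [S_rep S_lt].
have [q [m [B [lt_Nq gm B_lt B_rep le_qB]]]] :=
  dense_finite_ruler (4 * k.+1 * g * n + g * (n + k).+1) g_gt0.
(* q is also large enough for n + k < m *)
have lt_gq : g * (n + k).+1 < q by apply: leq_ltn_trans lt_Nq; apply: leq_addl.
have lt_nk_m : n + k < m by rewrite -(leq_pmul2l g_gt0) gm; nia.
have le_nm : n <= m by lia.
exists (2 * m + n), (glue n m S B); split.
- by split; [exact: (glue_rep B_rep B_lt g_gt0 le_nm S_rep) | exact: glue_lt].
- by lia.
- by move=> x lt_xn; rewrite /glue lt_xn.
have := leq_trans le_qB (@count_glue g n m S B B_rep).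
move: (count_lt (glue _ _ _ _) _) => c le_qc.
have le_gm : g * m <= q * q by rewrite gm; lia.
(* at most g * n elements are discarded, and Y is k.+1 times this number *)
pose Y := k.+1 * (g * n).
have big_q : 4 * Y <= q.
  by rewrite /Y !mulnA; apply: ltnW (leq_ltn_trans (leq_addr _ _) lt_Nq).
have big_c : k * q + 3 * Y <= k.+1 * c.
  have := leq_mul (leqnn k.+1) le_qc; rewrite mulnDr (mulnC n) -/Y mulSn; lia.
have le_Y : g * n * (k * k) <= Y * (k * q).
  rewrite /Y (mulnC k.+1) -[X in _ <= X]mulnA leq_mul2l; apply/orP; right.
  by apply: leq_mul => //; apply: leq_pmulr; lia.
rewrite -!mulnn; apply: leq_trans (leq_mul (leqnn 2) (leq_mul big_c big_c)).
have := leq_mul le_gm (leqnn (k * k)); nia.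
Qed.

Lemma exists_dense_ruler g : 0 < g -> exists A : set nat, golomb_ruler g A /\
  forall k : nat, exists2 n : nat, (k < n)%N &
     (g * n * k ^ 2 <= 2 * (k.+1 * count_lt (fun x => x \in A) n) ^ 2)%N.
Proof.
move=> g_gt0.
pose T := {p : nat * pred nat | bounded_ruler g p.1 p.2}.
pose step k (s t : T) := [/\ maxn (sval s).1 k < (sval t).1,
  (forall x, x < (sval s).1 -> (sval t).2 x = (sval s).2 x) &
  g * (sval t).1 * k ^ 2 <= 2 * (k.+1 * count_lt (sval t).2 (sval t).1) ^ 2].
have ex_step (ks : nat * T) : {t : T | step ks.1 ks.2 t}.
  apply: cid; case: ks => k [[n S] Sr].
  have [n' [S' [Sr' h1 h2 h3]]] := extend_ruler k g_gt0 Sr.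
  by exists (exist _ (n', S') Sr'); split.
pose s0 : nat * pred nat := (0, xpred0).
have F0 : bounded_ruler g s0.1 s0.2.
  by split=> // d [|b s].
pose F := nat_rect (fun _ => T) (exist _ s0 F0)
  (fun k s => sval (ex_step (k, s))).
have F_step k : step k (F k) (F k.+1) by exact: svalP (ex_step (k, F k)).
pose N k := (sval (F k)).1; pose S k := (sval (F k)).2.
have N_lt k : k <= N k.
  by case: k => // k; have [h _ _] := F_step k; rewrite /N; lia.
have NS k : N k < N k.+1 by have [h _ _] := F_step k; rewrite /N; lia.
have N_homo i j : i <= j -> N i <= N j.
  by move/subnKC <-; elim: (j - i) => [|d IH]; rewrite ?addn0 // addnS ltnW //;
     apply: leq_ltn_trans IH _.
have S_ext i j x : i <= j -> x < N i -> S j x = S i x.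
  move/subnKC <- => lt_x; elim: (j - i) => [|d IH]; first by rewrite addn0.
  have [_ h _] := F_step (i + d).
  rewrite addnS -IH [LHS]h //.
  by apply: leq_trans lt_x (N_homo _ _ (leq_addr _ _)).
(* the k-th ruler S k is the limit ruler below N k, and x < N x.+1 *)
pose A : set nat := [set x | S x.+1 x]%classic.
have A_S k x : x < N k -> (x \in A) = S k x.
  move=> lt_x; have -> : (x \in A) = S x.+1 x.
    by apply/idP/idP => [/set_mem|] //; exact: mem_set.
  have [le|/ltnW le] := leqP k x.+1; first by rewrite (S_ext _ _ _ le).
  by rewrite -(S_ext _ _ _ le) // N_lt.
exists A; split.
  apply/golombP => d s d_gt0 s_uniq /allP sA.
  (* all occurrences of d listed in s lie in a single finite ruler *)
  have [/(_ d s d_gt0 s_uniq) h _] := svalP (F (sumn s + d).+1); apply: h.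
  apply/allP => b bs; have := sA _ bs.
  have le_b : b <= sumn s.
    by rewrite sumnE (big_rem b) //= leq_addr.
  have le_N := N_lt (sumn s + d).+1.
  by rewrite !(A_S (sumn s + d).+1) //; lia.
move=> k; exists (N k.+1); first by have [] := F_step k; rewrite /N; lia.
have [_ _] := F_step k; rewrite -/(N _) -/(S _).
rewrite (_ : count_lt (S k.+1) _ = count_lt (fun x => x \in A) (N k.+1)) //.
apply: eq_in_count => x; rewrite mem_iota => /andP[_ lt_x].
by rewrite (A_S k.+1).
Qed.

(** * The window argument *)

(** A form of the Cauchy-Schwarz inequality. *)
Lemma sum_sq_le (I : Type) (r : seq I) (c : I -> nat) :
  (\sum_(i <- r) c i) ^ 2 <= size r * \sum_(i <- r) c i ^ 2.
Proof.
rewrite -(leq_pmul2l (isT : 0 < 2)).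
have -> : 2 * (\sum_(i <- r) c i) ^ 2 =
    \sum_(i <- r) \sum_(j <- r) 2 * (c i * c j).
  rewrite expnS expn1 big_distrlr big_distrr /=.
  by apply: eq_bigr => i _; rewrite big_distrr.
have -> : 2 * (size r * \sum_(i <- r) c i ^ 2) =
    \sum_(i <- r) \sum_(j <- r) (c i ^ 2 + c j ^ 2).
  under [RHS]eq_bigr => i _ do
    rewrite big_split /= big_const_seq count_predT iter_addn_0.
  rewrite big_split /= big_const_seq count_predT iter_addn_0 -big_distrl /=.
  by rewrite mulnC (mulnC (size r)) muln2 addnn.
by apply: leq_sum => i _; apply: leq_sum => j _; apply: nat_Cauchy.
Qed.

Section Windows.
Variables (g n w : nat) (P : pred nat).
Hypothesis P_rep : repeats_le g P.

Let N := count_lt P n.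

(* The element at offset i of the window ending in u, when it lies below n. *)
Let F u i := [&& i <= u, u < i + n & P (u - i)].

Lemma window_row i : i < w -> \sum_(0 <= u < n + w) F u i = N.
Proof.
move=> lt_iw; rewrite /N count_lt_sum.
rewrite (big_cat_nat (n := i)) //=; last by lia.
rewrite (big_cat_nat (m := i) (n := i + n)) /=; [|lia|lia].
have -> : \sum_(0 <= u < i) F u i = 0.
  by rewrite big_nat big1 // => u h; rewrite /F leqNgt (_ : u < i) //; lia.
have -> : \sum_(i + n <= u < n + w) F u i = 0.
  rewrite big_nat big1 // => u h.
  by rewrite /F ltnNge (_ : i + n <= u) ?andbF //; lia.
rewrite add0n addn0.
rewrite -{1}[i]add0n (addnC i) big_addn addnK.
apply: eq_big_nat => x lt_xn; rewrite /F addnK leq_addl /=.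
by rewrite (_ : x + i < i + n) //; lia.
Qed.

(** The number of windows with an element at both offsets [i] and [j] is the
    number of occurrences of the difference [j - i]. *)
Lemma window_pair i j : i < j -> \sum_(0 <= u < n + w) F u i * F u j <= g.
Proof.
move=> lt_ij; pose Q u := F u i && F u j.
have -> : \sum_(0 <= u < n + w) F u i * F u j = count Q (iota 0 (n + w)).
  rewrite -sum1_count [RHS]big_mkcond /= /index_iota subn0.
  by apply: eq_bigr => u _; rewrite /Q; case: (F u i); case: (F u j).
rewrite -size_filter -(size_map (fun u => u - j)).
have d_gt0 : 0 < j - i by lia.
apply: (P_rep d_gt0).
  rewrite map_inj_in_uniq ?filter_uniq ?iota_uniq // => x y.
  rewrite !mem_filter => /andP[/andP[_ /and3P[hx _ _]] _].
  by move=> /andP[/andP[_ /and3P[hy _ _]] _]; lia.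
apply/allP => _ /mapP[u + ->]; rewrite mem_filter.
move=> /andP[/andP[/and3P[h1 _ p1] /and3P[h2 _ p2]] _].
by rewrite p2 (_ : u - j + (j - i) = u - i) //; lia.
Qed.

Lemma window_bound : w * N ^ 2 <= (n + w) * (N + w * g).
Proof.
have [->|w_gt0] := posnP w; first by rewrite mul0n.
pose c u := \sum_(0 <= i < w) F u i.
have sum_c : \sum_(0 <= u < n + w) c u = w * N.
  rewrite /c exchange_big_nat /=.
  under eq_big_nat => i /andP[_ hi] do rewrite window_row //.
  by rewrite sum_nat_const_nat subn0.
have sum_c2 : \sum_(0 <= u < n + w) c u ^ 2 <= w * (N + w * g).
  have -> : \sum_(0 <= u < n + w) c u ^ 2 =
      \sum_(0 <= i < w) \sum_(0 <= j < w) \sum_(0 <= u < n + w) F u i * F u j.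
    under eq_bigr => u _ do rewrite /c expnS expn1 big_distrlr /=.
    rewrite exchange_big_nat /=; apply: eq_bigr => i _.
    by rewrite exchange_big_nat.
  apply: (@leq_trans (\sum_(0 <= i < w) (N + w * g))); last first.
    by rewrite sum_nat_const_nat subn0.
  rewrite big_nat [X in _ <= X]big_nat; apply: leq_sum => i /andP[_ lt_iw].
  apply: (@leq_trans (\sum_(0 <= j < w) ((j == i) * N + g))).
    rewrite big_nat [X in _ <= X]big_nat; apply: leq_sum => j /andP[_ lt_jw].
    have [lt_ji|lt_ij|->] := ltngtP j i.
    - rewrite mul0n; apply: leq_trans (window_pair lt_ji).
      by apply: leq_sum => u _; rewrite mulnC.
    - by rewrite mul0n; apply: window_pair.
    - rewrite mul1n -(window_row lt_iw); apply: leq_trans (leq_addr _ _).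
      by apply: leq_sum => u _; rewrite mulnb andbb.
  rewrite big_split /= sum_nat_const_nat subn0 leq_add2r -big_distrl /=.
  rewrite -[X in _ <= X]mul1n leq_mul2r; apply/orP; right.
  rewrite -/(index_iota _ _) -big_mkcondr /= sum1_count.
  by rewrite count_uniq_mem ?iota_uniq // leq_b1.
rewrite -(leq_pmul2l w_gt0) mulnA.
rewrite (_ : w * w * N ^ 2 = (w * N) ^ 2); last by rewrite expnMn expnS expn1.
rewrite -sum_c; apply: leq_trans (sum_sq_le _ _) _.
by rewrite size_iota subn0 mulnCA leq_mul2l sum_c2 orbT.
Qed.
End Windows.

(** The window length is [n %/ k + 1], so that [n < k * w]. *)
Lemma golomb_count_le g P n k : 0 < k -> repeats_le g P ->
  (count_lt P n - k.+1) ^ 2 <= (n + n %/ k + 1) * g.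
Proof.
move=> k_gt0 P_rep; pose w := (n %/ k).+1.
have lt_nkw : n < k * w by rewrite mulnC -ltn_divLR.
have := window_bound n w P_rep; set N := count_lt P n => h.
have w_gt0 : 0 < w by [].
rewrite -(leq_pmul2l w_gt0) (_ : n + n %/ k + 1 = n + w); last by rewrite /w; lia.
have [le_N|lt_N] := leqP N k.+1.
  by rewrite (_ : N - k.+1 = 0) ?muln0 //; lia.
have [M def_N] : exists M, N = M + k.+1 by exists (N - k.+1); lia.
have le_nw : n + w <= k.+1 * w by rewrite mulSn addnC leq_add2l ltnW.
suff sq : w * (N - k.+1) ^ 2 + (n + w) * N <= w * N ^ 2.
  rewrite -(leq_add2r ((n + w) * N)); apply: leq_trans sq (leq_trans h _).
  by rewrite mulnDr addnC mulnCA.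
apply: leq_trans (leq_add (leqnn _) (leq_mul le_nw (leqnn N))) _.
rewrite def_N addnK -!mulnn (mulnC k.+1 w) -mulnA -mulnDr leq_mul2l.
by apply/orP; right;
   rewrite [X in _ <= X]mulnDl leq_add2r leq_mul2l leq_addr orbT.
Qed.

(** * Limits superior *)

Section Limsup.
Variables (R : realType) (u : (\bar R)^nat) (c : \bar R).
Local Open Scope ereal_scope.

Lemma limn_esup_le m : (forall n, (m <= n)%N -> u n <= c) -> limn_esup u <= c.
Proof.
move=> u_le; apply: 
  (@le_trans _ _ (ereal_sup [set u x | x in [set n | (m <= n)%N]]%classic)).
  apply: ereal_inf_lbound => /=; exists [set n | (m <= n)%N]%classic => //.
  by exists m => // n.
by apply: ge_ereal_sup => _ [n /= mn <-]; apply: u_le.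
Qed.

Lemma limn_esup_ge :
  (forall m, exists2 n, (m <= n)%N & c <= u n) -> c <= limn_esup u.
Proof.
move=> u_ge; apply: le_ereal_inf_tmp => _ [V [m _ mV] <-].
have [n mn cu] := u_ge m; apply: le_trans cu _; apply: ereal_sup_ubound.
by exists n => //; apply: mV.
Qed.
End Limsup.

Section Limit.
Variables (R : realType) (g : nat).
Local Open Scope ring_scope.

Lemma ruler_limsup_le (A : set nat) : golomb_ruler g A ->
  (ruler_limsup R A <= (Num.sqrt (g%:R : R))%:E)%E.
Proof.
move=> /golombP A_rep; apply/lee_addgt0Pr => e e_gt0.
set r := Num.sqrt (g%:R : R).
have r_ge0 : 0 <= r by rewrite sqrtr_ge0.
(* the bound below is r + (r + 1) / k once sqrt n is at least k * (k + 1) *)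
pose k := (Num.trunc ((r + 1) / e)).+1.
have k_big : (r + 1) / e < k%:R by rewrite /k Num.Theory.truncnS_gt.
have k_gt0 : 0 < k%:R :> R by rewrite ltr0n.
apply: (@limn_esup_le _ _ _ ((k * k.+1) ^ 2)%N) => n le_n.
rewrite -EFinD lee_fin count_belowE; set N := count_lt _ n.
have n_gt0 : (0 < n)%N by apply: leq_trans le_n; rewrite expn_gt0.
set s := Num.sqrt (n%:R : R).
have s_gt0 : 0 < s by rewrite sqrtr_gt0 ltr0n.
have s2 : s ^+ 2 = n%:R by rewrite sqr_sqrtr ?ler0n.
have r2 : r ^+ 2 = g%:R by rewrite sqr_sqrtr ?ler0n.
rewrite ler_pdivrMr //.
have ks : k%:R * k.+1%:R <= s.
  rewrite -(@ler_pXn2r _ 2) ?nnegrE ?(ltW s_gt0) ?mulr_ge0 ?ler0n // s2.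
  by rewrite -natrM -natrX ler_nat.
pose M := (N - k.+1)%N.
have le_kn : (k <= n)%N by apply: leq_trans le_n; rewrite -mulnn; nia.
have hM : ((k * M) ^ 2 <= k.+1 ^ 2 * (g * n))%N.
  have /(_ k isT) := golomb_count_le n _ A_rep; rewrite -/N -/M => h.
  have h' : (k * (n + n %/ k + 1) <= k.+2 * n)%N.
    have := leq_trunc_div n k; nia.
  rewrite expnMn -mulnn -mulnA.
  apply: (@leq_trans (k * (k.+2 * n * g))).
    rewrite leq_mul2l (leq_trans (leq_mul (leqnn k) h)) ?orbT //.
    by rewrite mulnA leq_mul2r h' orbT.
  by rewrite mulnCA -!mulnA (mulnC g) !mulnA !leq_mul2r; lia.
have kM : k%:R * M%:R <= k.+1%:R * (r * s).
  rewrite -(@ler_pXn2r _ 2) ?nnegrE ?mulr_ge0 ?ler0n ?(ltW s_gt0) //.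
  by rewrite !exprMn r2 s2 -exprMn -!natrX -!natrM -natrX ler_nat.
have N_le : N%:R <= M%:R + k.+1%:R :> R.
  by rewrite -natrD ler_nat /M; lia.
have ke : r + 1 <= k%:R * e by rewrite -ler_pdivrMr // ltW.
rewrite -(ler_pM2l k_gt0).
apply: (@le_trans _ _ (k.+1%:R * (r * s) + s)).
  apply: le_trans (_ : k%:R * (M%:R + k.+1%:R) <= _); first by rewrite ler_pM2l.
  by rewrite mulrDr lerD.
rewrite -subr_ge0 (_ : _ - _ = s * (k%:R * e - (r + 1))).
  by rewrite mulr_ge0 ?subr_ge0 // ltW.
by rewrite -natr1; ring.
Qed.

(** The hypothesis says that the ratio of the counting function to [sqrt n] is
    infinitely often at least [sqrt (g / 2) * (k / (k + 1))]. *)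
Lemma ruler_limsup_ge (A : set nat) :
  (forall k : nat, exists2 n : nat, (k < n)%N &
     (g * n * k ^ 2 <= 2 * (k.+1 * count_lt (fun x => x \in A) n) ^ 2)%N) ->
  ((1 / Num.sqrt (2 : R) * Num.sqrt (g%:R : R))%:E <= ruler_limsup R A)%E.
Proof.
move=> dense; set L := _ * _.
have L_ge0 : 0 <= L by rewrite mulr_ge0 ?divr_ge0 ?sqrtr_ge0.
have L2 : 2 * L ^+ 2 = g%:R.
  by rewrite exprMn expr_div_n expr1n !sqr_sqrtr ?ler0n //; field.
apply/lee_addgt0Pr => e e_gt0; rewrite -leeBlDr // -EFinB.
apply: limn_esup_ge => m.
pose k := maxn m (Num.trunc (L / e)).+1.
have k_big : L / e < k%:R.
  by apply: lt_le_trans (Num.Theory.truncnS_gt _) _; rewrite ler_nat leq_maxr.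
have [n lt_kn h] := dense k; exists n.
  by rewrite (leq_trans _ (ltnW lt_kn)) ?leq_maxl.
rewrite lee_fin count_belowE; move: h; set N := count_lt _ n => h.
set s := Num.sqrt (n%:R : R).
have s_gt0 : 0 < s by rewrite sqrtr_gt0 ltr0n; lia.
have s2 : s ^+ 2 = n%:R by rewrite sqr_sqrtr ?ler0n.
rewrite ler_pdivlMr //.
have k1_gt0 : 0 < k.+1%:R :> R by rewrite ltr0n.
have main : k%:R * (L * s) <= k.+1%:R * N%:R.
  rewrite -(@ler_pXn2r _ 2) ?nnegrE ?mulr_ge0 ?ler0n ?(ltW s_gt0) //.
  move: h; rewrite -(ler_nat R) -!mulnn !natrM -L2 -s2 => h.
  rewrite -(@ler_pM2l _ 2) //; apply: le_trans (le_trans _ h) _;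
    by rewrite le_eqVlt; apply/orP; left; apply/eqP; ring.
rewrite -(ler_pM2l k1_gt0); apply: le_trans main.
have Le : L <= e * k%:R by rewrite mulrC -ler_pdivrMr // ltW.
rewrite -subr_ge0 (_ : _ - _ = s * (e * k%:R - L + e)).
  apply: mulr_ge0; first exact: ltW.
  by apply: addr_ge0; [rewrite subr_ge0 | exact: ltW].
by rewrite -natr1; ring.
Qed.
End Limit.

Local Open Scope classical_set_scope.
Local Open Scope ring_scope.

Theorem theorem3 (R : realType) (g : nat) (hg : (1 <= g)%N) :
  (forall A : set nat, golomb_ruler g A ->
     (ruler_limsup R A <= (Num.sqrt (g%:R : R))%:E)%E) /\
  (exists G : set nat, golomb_ruler g G /\
     ((1 / Num.sqrt (2 : R) * Num.sqrt (g%:R : R))%:E <= ruler_limsup R G)%E).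
Proof.
split=> [A|]; first exact: ruler_limsup_le.
have [G [G_g G_dense]] := exists_dense_ruler hg.
by exists G; split=> //; apply: ruler_limsup_ge.
Qed.
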